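(* Let $U\subseteq\mathbb H$ be an axially symmetric domain (connected open set) and let $f:U\to\mathbb H$ be a left slice hyperholomorphic function. Let $g=Df$. If $q=u+I_{\underline q}v\in U\setminus\mathbb R$, where $u=q_0$, $v=|\underline q|$, $I_{\underline q}=\underline q/|\underline q|$, then for every $I\in\mathbb S$ $$g(q)=Df(q)=-(\underline q)^{-1}I_{\underline q}I\,[f(u-Iv)-f(u+Iv)],$$ and $g$ is constant on each sphere $[q]$ with $q\in U\setminus\mathbb R$. If $q=u\in U\cap\mathbb R$, then $$g(u)=Df(u)=-2\,\frac{\partial}{\partial u}f(u).$$
   Context: $\mathbb H$ denotes the quaternions $q=q_0+q_1e_1+q_2e_2+q_3e_3$ ($q_i\in\mathbb R$, $e_1^2=e_2^2=e_3^2=-1$, $e_1e_2=-e_2e_1=e_3$, $e_2e_3=-e_3e_2=e_1$, $e_3e_1=-e_1e_3=e_2$), $\underline q=q_1e_1+q_2e_2+q_3e_3$, and $|q|$ is the Euclidean norm. $\mathbb S=\{\underline q: |\underline q|=1\}$ is the sphere of imaginary units, and $[q]=\{q_0+I|\underline q| : I\in\mathbb S\}$. A set $U\subseteq\mathbb H$ is axially symmetric if $[q]\subset U$ for all $q\in U$. Slice hyperholomorphic functions: let $U$ be an axially symmetric open set and $\mathcal U=\{(u,v)\in\mathbb R^2: u+\mathbb Sv\subset U\}$. A function $f:U\to\mathbb H$ is left slice hyperholomorphic if $f(u+Iv)=\alpha(u,v)+I\beta(u,v)$ for all $(u,v)\in\mathcal U$, $I\in\mathbb S$, with $C^1$ functions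 $\alpha,\beta:\mathcal U\to\mathbb H$ satisfying $\alpha(u,v)=\alpha(u,-v)$, $\beta(u,v)=-\beta(u,-v)$ and $\partial_u\alpha-\partial_v\beta=0$, $\partial_v\alpha+\partial_u\beta=0$. The Cauchy–Fueter operator is $Df=\partial_{q_0}f+e_1\partial_{q_1}f+e_2\partial_{q_2}f+e_3\partial_{q_3}f$ (units multiplied on the left). *)

(* Defs.v *)
From HB Require Import structures.
From mathcomp Require Import all_boot all_order all_algebra.
From mathcomp Require Import ring lra.
From mathcomp Require Import all_classical all_reals all_analysis.
Set Implicit Arguments.
Unset Strict Implicit.
Unset Printing Implicit Defensive.
Import Order.TTheory GRing.Theory Num.Theory.
Import numFieldNormedType.Exports.
Local Open Scope classical_set_scope.
Local Open Scope ring_scope.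

(* The quaternions q0 + q1 e1 + q2 e2 + q3 e3, as R^4 with the Hamilton
   product.  The topology, the limits and the directional derivatives are those
   of R^4.  Pitfall: the norm `|q| inherited from 'rV[R]_4 is the max norm; the
   Euclidean norm is qabs below. *)
Definition quat (R : realType) : Type := 'rV[R]_4.

HB.instance Definition _ (R : realType) :=
  NormedModule.on (quat R).

Section Quaternions.
Variable R : realType.
Implicit Types p q r : quat R.

Definition qcoord q (i : 'I_4) : R := (q : 'rV[R]_4) 0 i.

Definition mkquat (a b c d : R) : quat R :=
  (\row_(i < 4) nth 0 [:: a; b; c; d] i : 'rV[R]_4).

Lemma mkquatE a b c d : (qcoord (mkquat a b c d) 0 = a) *
  (qcoord (mkquat a b c d) 1 = b) * (qcoord (mkquat a b c d) 2 = c) *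
  (qcoord (mkquat a b c d) 3 = d).
Proof. by rewrite /qcoord !mxE. Qed.

Lemma qcoordD p q i : qcoord (p + q) i = qcoord p i + qcoord q i.
Proof. exact: mxE. Qed.

Lemma qcoordN q i : qcoord (- q) i = - qcoord q i.
Proof. exact: mxE. Qed.

Lemma qcoordZ a q i : qcoord (a *: q) i = a * qcoord q i.
Proof. exact: mxE. Qed.

Lemma qcoord0 i : qcoord 0 i = 0.
Proof. exact: mxE. Qed.

Lemma quatP p q : qcoord p 0 = qcoord q 0 -> qcoord p 1 = qcoord q 1 ->
  qcoord p 2 = qcoord q 2 -> qcoord p 3 = qcoord q 3 -> p = q.
Proof.
move=> h0 h1 h2 h3; apply/rowP; case=> -[|[|[|[|//]]]] lti.
- by move: h0; rewrite /qcoord; congr (_ = _); congr (fun_of_matrix _ _ _);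
    apply/val_inj.
- by move: h1; rewrite /qcoord; congr (_ = _); congr (fun_of_matrix _ _ _);
    apply/val_inj.
- by move: h2; rewrite /qcoord; congr (_ = _); congr (fun_of_matrix _ _ _);
    apply/val_inj.
- by move: h3; rewrite /qcoord; congr (_ = _); congr (fun_of_matrix _ _ _);
    apply/val_inj.
Qed.

Definition qone : quat R := mkquat 1 0 0 0.

Definition qmul p q : quat R :=
  let p0 := qcoord p 0 in let p1 := qcoord p 1 in
  let p2 := qcoord p 2 in let p3 := qcoord p 3 in
  let q0 := qcoord q 0 in let q1 := qcoord q 1 in
  let q2 := qcoord q 2 in let q3 := qcoord q 3 in
  mkquat (p0 * q0 - p1 * q1 - p2 * q2 - p3 * q3)
         (p0 * q1 + p1 * q0 + p2 * q3 - p3 * q2)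
         (p0 * q2 - p1 * q3 + p2 * q0 + p3 * q1)
         (p0 * q3 + p1 * q2 - p2 * q1 + p3 * q0).

Definition qsqnorm q : R := \sum_(i < 4) qcoord q i ^+ 2.

Definition qconj q : quat R :=
  mkquat (qcoord q 0) (- qcoord q 1) (- qcoord q 2) (- qcoord q 3).

Definition qinv q : quat R := (qsqnorm q)^-1 *: qconj q.

Lemma qsqnormE q : qsqnorm q =
  qcoord q 0 ^+ 2 + qcoord q 1 ^+ 2 + qcoord q 2 ^+ 2 + qcoord q 3 ^+ 2.
Proof.
rewrite /qsqnorm !big_ord_recl big_ord0 addr0 !addrA.
by congr (qcoord q _ ^+ 2 + qcoord q _ ^+ 2 + qcoord q _ ^+ 2 + qcoord q _ ^+ 2);
  apply/val_inj.
Qed.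

Lemma qsqnorm_eq0 q : (qsqnorm q == 0) = (q == 0).
Proof.
apply/eqP/eqP => [|->]; last first.
  by rewrite qsqnormE !qcoord0 expr0n /= !addr0.
rewrite qsqnormE => h.
have := sqr_ge0 (qcoord q 0); have := sqr_ge0 (qcoord q 1).
have := sqr_ge0 (qcoord q 2); have := sqr_ge0 (qcoord q 3).
move=> h3 h2 h1 h0.
by apply: quatP; rewrite qcoord0; apply/eqP; rewrite -sqrf_eq0; apply/eqP; lra.
Qed.

Let coordE := (mkquatE, qcoordD, qcoordN, qcoordZ, qcoord0).

Lemma qmulA : associative qmul.
Proof. by move=> p q r; apply: quatP; rewrite /qmul !coordE; ring. Qed.

Lemma qmul1l : left_id qone qmul.
Proof. by move=> p; apply: quatP; rewrite /qmul !coordE; ring. Qed.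

Lemma qmul1r : right_id qone qmul.
Proof. by move=> p; apply: quatP; rewrite /qmul !coordE; ring. Qed.

Lemma qmulDl : left_distributive qmul +%R.
Proof. by move=> p q r; apply: quatP; rewrite /qmul !coordE; ring. Qed.

Lemma qmulDr : right_distributive qmul +%R.
Proof. by move=> p q r; apply: quatP; rewrite /qmul !coordE; ring. Qed.

Lemma qone_neq0 : qone != 0.
Proof.
apply/eqP => /(congr1 (fun q => qcoord q 0)); rewrite !coordE.
exact/eqP/oner_neq0.
Qed.

HB.instance Definition _ := GRing.Zmodule_isNzRing.Build (quat R)
  qmulA qmul1l qmul1r qmulDl qmulDr qone_neq0.

Lemma qscaleAl (a : R) p q : a *: (p * q) = a *: p * q.
Proof. by apply: quatP; rewrite /GRing.mul/= /qmul !coordE; ring. Qed.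

HB.instance Definition _ :=
  GRing.Lmodule_isLalgebra.Build R (quat R) qscaleAl.

Lemma qscaleAr (a : R) p q : a *: (p * q) = p * (a *: q).
Proof. by apply: quatP; rewrite /GRing.mul/= /qmul !coordE; ring. Qed.

HB.instance Definition _ :=
  GRing.Lalgebra_isAlgebra.Build R (quat R) qscaleAr.

Lemma qmulVq : {in [pred q : quat R | q != 0], left_inverse 1 qinv *%R}.
Proof.
move=> q; rewrite inE -qsqnorm_eq0 qsqnormE => q0.
by apply: quatP;
  rewrite /GRing.mul/= /qmul /qinv qsqnormE !coordE; field.
Qed.

Lemma qmulqV : {in [pred q : quat R | q != 0], right_inverse 1 qinv *%R}.
Proof.
move=> q; rewrite inE -qsqnorm_eq0 qsqnormE => q0.
by apply: quatP;
  rewrite /GRing.mul/= /qmul /qinv qsqnormE !coordE; field.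
Qed.

Lemma qunitP p q : q * p = 1 /\ p * q = 1 -> p != 0.
Proof.
by move=> [+ _]; apply: contra_eq_neq => ->; rewrite mulr0 eq_sym oner_neq0.
Qed.

Lemma qinv_out : {in [predC [pred q : quat R | q != 0]], qinv =1 id}.
Proof.
move=> q; rewrite !inE negbK => /eqP ->.
by apply: quatP; rewrite /qinv !coordE; ring.
Qed.

HB.instance Definition _ := GRing.NzRing_hasMulInverse.Build (quat R)
  qmulVq qmulqV qunitP qinv_out.

(* e_0 = 1, e_1, e_2, e_3 *)
Definition qe (i : 'I_4) : quat R := (delta_mx 0 i : 'rV[R]_4).

Lemma qe_mulE : [/\ qe 0 = 1,
  [/\ qe 1 * qe 1 = -1, qe 2 * qe 2 = -1 & qe 3 * qe 3 = -1],
  qe 1 * qe 2 = qe 3 /\ qe 2 * qe 1 = - qe 3,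
  qe 2 * qe 3 = qe 1 /\ qe 3 * qe 2 = - qe 1 &
  qe 3 * qe 1 = qe 2 /\ qe 1 * qe 3 = - qe 2].
Proof.
have qeE i j : qcoord (qe i) j = (j == i)%:R by rewrite /qcoord mxE.
have q1E : (1 : quat R) = mkquat 1 0 0 0 by [].
have qmE p q : p * q = qmul p q by [].
by do !split; apply: quatP;
  rewrite ?qmE /qmul ?q1E !(coordE, qeE) /=; ring.
Qed.

Definition qabs q : R := Num.sqrt (qsqnorm q).

Definition qre q : R := qcoord q 0.

(* the vector part of q; here a%:A = a *: 1 is the embedding of R *)
Definition qvec q : quat R := q - (qre q)%:A.

Definition qreals : set (quat R) := [set u%:A | u in [set: R]].

Definition imunits : set (quat R) := [set I | qre I = 0 /\ qabs I = 1].

Definition qsphere q : set (quat R) :=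
  [set (qre q)%:A + qabs (qvec q) *: I | I in imunits].

Definition axially_symmetric (U : set (quat R)) : Prop :=
  forall q, U q -> qsphere q `<=` U.

Definition slice_dom (U : set (quat R)) : set (R * R) :=
  [set z | forall I, imunits I -> U (z.1%:A + z.2 *: I)].

Definition d_u (a : R * R -> quat R) : R * R -> quat R := 'D_(1, 0) a.
Definition d_v (a : R * R -> quat R) : R * R -> quat R := 'D_(0, 1) a.

(* C^1 on the open set W *)
Definition C1_on (W : set (R * R)) (a : R * R -> quat R) : Prop :=
  [/\ forall z, W z -> derivable a z (1, 0) /\ derivable a z (0, 1),
      {within W, continuous (d_u a)} & {within W, continuous (d_v a)}].

(* f, alpha and beta are total; only their values on U, resp. slice_dom U,
   matter. *)
Definition slice_hyperholomorphic (U : set (quat R)) (f : quat R -> quat R)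
    : Prop :=
  exists alpha beta : R * R -> quat R,
  [/\ C1_on (slice_dom U) alpha, C1_on (slice_dom U) beta,
      forall u v, slice_dom U (u, v) -> forall I, imunits I ->
        f (u%:A + v *: I) = alpha (u, v) + I * beta (u, v),
      forall u v, slice_dom U (u, v) ->
        alpha (u, v) = alpha (u, - v) /\ beta (u, v) = - beta (u, - v) &
      forall z, slice_dom U z ->
        d_u alpha z - d_v beta z = 0 /\ d_v alpha z + d_u beta z = 0].

Definition partials_exist (f : quat R -> quat R) q : Prop :=
  forall i : 'I_4, derivable f q (qe i).

Definition cauchy_fueter (f : quat R -> quat R) q : quat R :=
  \sum_(i < 4) qe i * 'D_(qe i) f q.

End Quaternions.

(* Main.v *)
(* Off the real axis f q = alpha(u, v) + w * (beta(u, v) / v), where w is the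
   vector part of q and v its norm.  Moving q along e_0 changes only u, and moving
   it along e_1, e_2 or e_3 changes only v and w, so each partial derivative is a
   one-variable chain rule; by the Cauchy-Riemann equations everything cancels in
   the sum except D f q = - 2 beta(u, v) / v, which depends only on the sphere of
   q.  At a real point u, f(u + t e_i) = alpha(u, t) + e_i beta(u, t) for t of
   either sign, and parity gives beta(u, 0) = 0 and d_v alpha(u, 0) = 0, so that
   D f u = d_u alpha - 3 d_v beta = - 2 d_u alpha. *)
Require Import Defs.
From HB Require Import structures.
From mathcomp Require Import all_boot all_order all_algebra.
From mathcomp Require Import ring lra.
From mathcomp Require Import all_classical all_reals all_analysis.
Set Implicit Arguments.
Unset Strict Implicit.
Unset Printing Implicit Defensive.
Import Order.TTheory GRing.Theory Num.Theory.
Import numFieldNormedType.Exports.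
Local Open Scope classical_set_scope.
Local Open Scope ring_scope.

(** Case analysis that presents the indices as the numerals in which the coordinate rules are
    written, so that these rules rewrite. *)
Lemma ord4_ind (P : 'I_4 -> Prop) : P 0 -> P 1 -> P 2 -> P 3 -> forall i, P i.
Proof.
move=> P0 P1 P2 P3; case=> -[|[|[|[|//]]]] lti.
- by rewrite (_ : Ordinal lti = 0)//; exact/val_inj.
- by rewrite (_ : Ordinal lti = 1)//; exact/val_inj.
- by rewrite (_ : Ordinal lti = 2)//; exact/val_inj.
- by rewrite (_ : Ordinal lti = 3)//; exact/val_inj.
Qed.

(** * Directional derivatives as derivatives of curves *)

Section CurveDerivatives.
Context {R : realType}.

(** Both derivatives are limits of the same difference quotient, once [h *: 1] is read as [h] and
    the base point as 0. Every partial derivative below becomes a one-variable computation in this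
    way. *)
Lemma is_derive_line {V W : normedModType R} (f : V -> W) (a v : V) (df : W) :
  is_derive (0 : R) 1 (fun t => f (t *: v + a)) df -> is_derive a v f df.
Proof.
move=> [d1 d2]; split; first exact: (derivable1P f a v).2 d1.
rewrite -d2 /derive; set g1 := fun h => h^-1 *: _; set g2 := fun h => h^-1 *: _.
suff -> : g1 = g2 by [].
by rewrite funeqE /g1 /g2 => h /=; rewrite addr0 scale0r add0r [h *: 1]mulr1.
Qed.

Lemma is_derive_along_line {V W : normedModType R} (f : V -> W) (a v : V) :
  derivable f a v -> is_derive (0 : R) 1 (fun t => f (t *: v + a)) ('D_v f a).
Proof.
move=> d1; split; first exact: (derivable1P f a v).1 d1.
rewrite /derive; set g1 := fun h => h^-1 *: _; set g2 := fun h => h^-1 *: _.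
suff -> : g1 = g2 by [].
by rewrite funeqE /g1 /g2 => h /=; rewrite addr0 scale0r add0r [h *: 1]mulr1.
Qed.

(** For functions of one real variable derivability is differentiability, so the chain rule for
    differentials applies; linearity of ['d a] pulls out the scalar [dr]. *)
Lemma is_derive_comp_real {W : normedModType R} (a : R -> W) (r : R -> R)
    (x dr : R) (da : W) :
  is_derive (r x) 1 a da -> is_derive x 1 r dr ->
  is_derive x 1 (a \o r) (dr *: da).
Proof.
move=> [a1 a2] [r1 r2].
have a3 : differentiable a (r x) by exact/derivable1_diffP.
have r3 : differentiable r x by exact/derivable1_diffP.
have c3 : differentiable (a \o r) x by exact: differentiable_comp.
split; first exact/derivable1_diffP.
rewrite deriveE// diff_comp//= -[X in 'd a _ X]deriveE// r2.
by rewrite -[dr in LHS]mulr1 -[dr * 1]/(dr *: 1) linearZ/= -deriveE// a2.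
Qed.

Lemma is_derive_quatP {V : normedModType R} (p : V -> quat R) (x w : V)
    (dp : quat R) :
  is_derive x w p dp <->
  (forall i, is_derive x w (fun y => qcoord (p y) i) (qcoord dp i)).
Proof.
split=> [[p1 p2] i|h].
  split; first exact: (derivable_mxP (p : V -> 'rV[R]_4) x w).1 p1 0 i.
  by rewrite -p2 (derive_mx p1) /qcoord mxE.
have p1 : derivable p x w.
  apply/(derivable_mxP (p : V -> 'rV[R]_4)) => i j.
  by rewrite (ord1 i); case: (h j).
split => //; apply/rowP => j; rewrite (derive_mx p1) mxE.
by case: (h j).
Qed.

End CurveDerivatives.

(** * Coordinates, product rules and the derivative of the norm *)

Section QuaternionProducts.
Context {R : realType}.
Implicit Types p q : quat R.

Lemma qcoordM p q :
  (qcoord (p * q) 0 = qcoord p 0 * qcoord q 0 - qcoord p 1 * qcoord q 1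
     - qcoord p 2 * qcoord q 2 - qcoord p 3 * qcoord q 3) *
  (qcoord (p * q) 1 = qcoord p 0 * qcoord q 1 + qcoord p 1 * qcoord q 0
     + qcoord p 2 * qcoord q 3 - qcoord p 3 * qcoord q 2) *
  (qcoord (p * q) 2 = qcoord p 0 * qcoord q 2 - qcoord p 1 * qcoord q 3
     + qcoord p 2 * qcoord q 0 + qcoord p 3 * qcoord q 1) *
  (qcoord (p * q) 3 = qcoord p 0 * qcoord q 3 + qcoord p 1 * qcoord q 2
     - qcoord p 2 * qcoord q 1 + qcoord p 3 * qcoord q 0).
Proof. by rewrite /GRing.mul/= /qmul !mkquatE. Qed.

Lemma qcoord1 : (qcoord (1 : quat R) 0 = 1) * (qcoord (1 : quat R) 1 = 0) *
  (qcoord (1 : quat R) 2 = 0) * (qcoord (1 : quat R) 3 = 0).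
Proof. by rewrite /GRing.one/= /qone !mkquatE. Qed.

Lemma qcoord_qe (i j : 'I_4) : qcoord (qe R i) j = (j == i)%:R.
Proof. by rewrite /qcoord mxE. Qed.

(** Turns a quaternion identity, after [quatP], into four real identities within reach of [ring] or
    [field]. *)
Definition qcoordE :=
  (qcoordM, qcoord1, @qcoordD R, @qcoordN R, @qcoordZ R, @qcoord0 R, qcoord_qe).

Lemma is_deriveMR {V : normedModType R} (f g : V -> R) (x w : V) (df dg : R) :
  is_derive x w f df -> is_derive x w g dg ->
  is_derive x w (fun y => f y * g y) (df * g x + f x * dg).
Proof. by move=> f' g'; apply: is_derive_eq; rewrite /GRing.scale/=; ring. Qed.

(** Each coordinate of a product is bilinear in the coordinates of the factors, so the scalar
    product rule suffices; the order of the factors is kept because they do not commute. *)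
Lemma is_deriveMq {V : normedModType R} (p q : V -> quat R) (x w : V)
    (dp dq : quat R) :
  is_derive x w p dp -> is_derive x w q dq ->
  is_derive x w (fun y => p y * q y) (dp * q x + p x * dq).
Proof.
move=> /is_derive_quatP p' /is_derive_quatP q'.
(* All sixteen scalar product rules enter the context, where the instance search behind
   [is_derive_eq] finds them. *)
have pq i j := is_deriveMR (p' i) (q' j).
apply/is_derive_quatP; elim/ord4_ind; under eq_fun do rewrite qcoordE;
  by apply: is_derive_eq; rewrite !qcoordE /GRing.scale/=; ring.
Qed.

Lemma is_deriveZq {V : normedModType R} (k : V -> R) (p : V -> quat R)
    (x w : V) (dk : R) (dp : quat R) :
  is_derive x w k dk -> is_derive x w p dp ->
  is_derive x w (fun y => k y *: p y) (dk *: p x + k x *: dp).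
Proof.
move=> k' /is_derive_quatP p'; apply/is_derive_quatP => i.
under eq_fun do rewrite qcoordZ.
rewrite qcoordD !qcoordZ; exact: is_deriveMR.
Qed.

Lemma is_derive_affine (q w : quat R) :
  is_derive (0 : R) 1 (fun t => t *: w + q) w.
Proof.
by apply/is_derive_quatP => i; under eq_fun do rewrite qcoordD qcoordZ;
  apply: is_derive_eq; rewrite /GRing.scale/=; ring.
Qed.

Lemma qsqnorm_qvec q :
  qsqnorm (qvec q) = qcoord q 1 ^+ 2 + qcoord q 2 ^+ 2 + qcoord q 3 ^+ 2.
Proof. by rewrite qsqnormE /qvec /qre !qcoordE; ring. Qed.

Lemma qabs_eq0 q : (qabs q == 0) = (q == 0).
Proof.
rewrite -qsqnorm_eq0 /qabs sqrtr_eq0 le_eqVlt orb_idr// => /lt_geF.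
by rewrite qsqnormE !addr_ge0 ?sqr_ge0.
Qed.

Lemma sqr_qabs q : qabs q ^+ 2 = qsqnorm q.
Proof. by rewrite sqr_sqrtr// qsqnormE !addr_ge0 ?sqr_ge0. Qed.

Lemma qabsZ (a : R) q : qabs (a *: q) = `|a| * qabs q.
Proof.
rewrite /qabs -sqrtr_sqr -sqrtrM ?sqr_ge0//; congr Num.sqrt.
by rewrite !qsqnormE !qcoordE; ring.
Qed.

Lemma qre_line (q : quat R) (i : 'I_4) (t : R) : i != 0 ->
  qre (t *: qe R i + q) = qre q.
Proof. by move=> i0; rewrite /qre !qcoordE eq_sym (negPf i0) mulr0 add0r. Qed.

Lemma qvec_line (q : quat R) (i : 'I_4) (t : R) : i != 0 ->
  qvec (t *: qe R i + q) = t *: qe R i + qvec q.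
Proof. by move=> i0; rewrite /qvec qre_line// addrA. Qed.

(** Along the line the squared norm of the vector part is the quadratic polynomial [s], with
    derivative [2 * qcoord q i] at 0. Its value there is positive, so the square root is derivable
    at it. *)
Lemma is_derive_qabs_line (q : quat R) (i : 'I_4) : i != 0 -> qvec q != 0 ->
  is_derive (0 : R) 1 (fun t => qabs (qvec (t *: qe R i + q)))
    (qcoord q i / qabs (qvec q)).
Proof.
move=> i0 q0.
have v0 : 0 < qabs (qvec q) by rewrite lt_def qabs_eq0 q0 sqrtr_ge0.
have sE t : qsqnorm (qvec (t *: qe R i + q)) =
    t ^+ 2 + t * (2 * qcoord q i) + qsqnorm (qvec q).
  rewrite !qsqnorm_qvec !qcoordE.
  by clear q0 v0; elim/ord4_ind: i i0 => //= _; ring.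
pose s t := t ^+ 2 + t * (2 * qcoord q i) + qsqnorm (qvec q).
have -> : (fun t => qabs (qvec (t *: qe R i + q))) = Num.sqrt \o s.
  by apply/funext => t /=; rewrite /qabs sE.
have s0 : s 0 = qsqnorm (qvec q) by rewrite /s; ring.
have ds : is_derive (0 : R) 1 s (2 * qcoord q i).
  by apply: is_derive_eq; rewrite /GRing.scale/=; ring.
have dr : is_derive (s 0) 1 Num.sqrt (2 * qabs (qvec q))^-1.
  by rewrite s0; apply: is_derive1_sqrt; rewrite -sqr_qabs exprn_gt0.
apply: is_derive_eq.
by field; rewrite gt_eqF.
Qed.

End QuaternionProducts.

Lemma big_ord4 (V : nmodType) (F : 'I_4 -> V) :
  \sum_(i < 4) F i = F 0 + F 1 + F 2 + F 3.
Proof.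
rewrite !big_ord_recl big_ord0 addr0 !addrA.
by congr (F _ + F _ + F _ + F _); exact/val_inj.
Qed.

(** * Imaginary units, spheres and the slice domain *)

Section ImaginaryUnits.
Context {R : realType}.
Implicit Types q I : quat R.

Lemma imunits_mulK I : imunits I -> I * I = -1.
Proof.
move=> [I0 /(congr1 (fun x => x ^+ 2))]; rewrite sqr_qabs qsqnormE expr1n.
rewrite /qre in I0; rewrite I0 => I1.
by apply: quatP; rewrite !qcoordE I0; lra.
Qed.

Lemma imunitsN I : imunits I -> imunits (- I).
Proof.
move=> [I0 I1]; split; first by rewrite /qre qcoordE [qcoord _ _]I0 oppr0.
by rewrite -scaleN1r qabsZ normrN1 mul1r.
Qed.

Lemma imunits_qe (i : 'I_4) : i != 0 -> imunits (qe R i).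
Proof.
move=> i0; split; first by rewrite /qre qcoordE eq_sym (negPf i0).
rewrite /qabs qsqnormE !qcoordE.
rewrite -[RHS]sqrtr1; congr Num.sqrt.
by elim/ord4_ind: i i0 => //= _; ring.
Qed.

Lemma imunits_qvec q : qvec q != 0 -> imunits ((qabs (qvec q))^-1 *: qvec q).
Proof.
move=> q0; have v0 : qabs (qvec q) != 0 by rewrite qabs_eq0.
split; first by rewrite /qre /qvec /qre !qcoordE; ring.
by rewrite qabsZ ger0_norm ?invr_ge0 ?sqrtr_ge0// mulVf.
Qed.

Lemma qsplit (u v : R) I : imunits I ->
  qre (u%:A + v *: I) = u /\ qvec (u%:A + v *: I) = v *: I.
Proof.
move=> [I0 _]; have e : qre (u%:A + v *: I) = u.
  by rewrite /qre !qcoordE [qcoord _ _]I0; ring.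
by split => //; rewrite /qvec e addrC addKr.
Qed.

Lemma qsphere_qabs q p : qsphere q p ->
  qre p = qre q /\ qabs (qvec p) = qabs (qvec q).
Proof.
move=> [I I1 <-]; have [-> ->] := qsplit (qre q) (qabs (qvec q)) I1.
by rewrite qabsZ I1.2 mulr1 ger0_norm ?sqrtr_ge0.
Qed.

Lemma qvec_eq0 q : qvec q = 0 <-> qreals q.
Proof.
split=> [/eqP|[u _ <-]]; first by rewrite subr_eq0 => /eqP e; exists (qre q).
by rewrite /qvec /qre !qcoordE mulr1 subrr.
Qed.

(** A single point of the sphere is enough, by axial symmetry. As [qsphere] has the nonnegative
    radius [|v|], a negative [v] is absorbed by passing from [J] to [- J]. *)
Lemma slice_dom_sphere (U : set (quat R)) (u v : R) I :
  axially_symmetric U -> imunits I -> U (u%:A + v *: I) -> slice_dom U (u, v).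
Proof.
move=> symU I1 UI J J1; apply: (symU _ UI); rewrite /qsphere.
have [-> ->] := qsplit u v I1; rewrite qabsZ I1.2 mulr1.
have [v0|v0] := leP 0 v; [exists J|exists (- J)] => //.
- by rewrite ger0_norm.
- exact: imunitsN.
- by rewrite ltr0_norm// scalerN scaleNr opprK.
Qed.

Lemma qpolar q : qvec q != 0 ->
  q = (qre q)%:A + qabs (qvec q) *: ((qabs (qvec q))^-1 *: qvec q).
Proof.
by move=> q0; rewrite scalerA divff ?qabs_eq0// scale1r /qvec addrC subrK.
Qed.

Lemma slice_dom_qvec (U : set (quat R)) q :
  axially_symmetric U -> U q -> qvec q != 0 ->
  slice_dom U (qre q, qabs (qvec q)).
Proof.
move=> symU Uq q0; apply: (slice_dom_sphere symU (imunits_qvec q0)).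
by rewrite -qpolar.
Qed.

(** The line is continuous and passes through [q] at 0. Formulas for [f] that hold only on [U] may
    therefore replace [f] when differentiating along it. *)
Lemma near_line (U : set (quat R)) q (w : quat R) :
  open U -> U q -> \forall t \near (0 : R), U (t *: w + q).
Proof.
move=> oU Uq.
have /differentiable_continuous : differentiable (fun t : R => t *: w + q) 0.
  by apply/derivable1_diffP; case: (is_derive_affine q w).
by apply; rewrite /= scale0r add0r; exact: open_nbhs_nbhs.
Qed.

End ImaginaryUnits.

(** * Identities for summing the four partial derivatives *)

Lemma addrD3 (V : nmodType) (a b1 b2 b3 c1 c2 c3 : V) :
  a + (b1 + c1) + (b2 + c2) + (b3 + c3) = a + (b1 + b2 + b3) + (c1 + c2 + c3).
Proof. by rewrite -!(addrA a) (addrACA b1) (addrACA (b1 + b2)). Qed.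

Lemma qe0 R : qe R 0 = 1.
Proof. by case: (qe_mulE R). Qed.

(** Collects the contributions due to the change of the norm [v], whose derivative along [e_i] is
    [q_i / v]. *)
Lemma sum_qe_vec (R : realType) (q p : quat R) :
  qe R 1 * (qcoord q 1 *: p) + qe R 2 * (qcoord q 2 *: p) +
  qe R 3 * (qcoord q 3 *: p) = qvec q * p.
Proof.
rewrite -!scalerAr !scalerAl -!mulrDl; congr (_ * _).
by apply: quatP; rewrite /qvec /qre !qcoordE/=; ring.
Qed.

(** Collects the contributions due to the change of the vector part itself: three squares, each
    equal to -1. *)
Lemma sum_qe_qe (R : realType) (p : quat R) :
  qe R 1 * (qe R 1 * p) + qe R 2 * (qe R 2 * p) + qe R 3 * (qe R 3 * p) =
  - (3 *: p).
Proof.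
have [_ [e1 e2 e3] _ _ _] := qe_mulE R.
rewrite !mulrA e1 e2 e3 !mulN1r -!opprD scaler_nat.
by rewrite !mulrS mulr0n addr0 addrA.
Qed.

Lemma qvec_sqr (R : realType) (q : quat R) :
  qvec q * qvec q = - (qabs (qvec q) ^+ 2)%:A.
Proof.
rewrite sqr_qabs qsqnorm_qvec.
by apply: quatP; rewrite /qvec /qre !qcoordE/=; ring.
Qed.

(** * Slice functions: derivatives at nonreal points *)

Section SliceFunctions.
Context {R : realType}.
Variables (U : set (quat R)) (f : quat R -> quat R).
Variables (alpha beta : R * R -> quat R).
Hypothesis openU : open U.
Hypothesis symU : axially_symmetric U.
Hypothesis alphaP : forall z, slice_dom U z ->
  derivable alpha z (1, 0) /\ derivable alpha z (0, 1).
Hypothesis betaP : forall z, slice_dom U z ->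
  derivable beta z (1, 0) /\ derivable beta z (0, 1).
Hypothesis fE : forall u v, slice_dom U (u, v) -> forall I, imunits I ->
  f (u%:A + v *: I) = alpha (u, v) + I * beta (u, v).
Hypothesis parity : forall u v, slice_dom U (u, v) ->
  alpha (u, v) = alpha (u, - v) /\ beta (u, v) = - beta (u, - v).
Hypothesis CR : forall z, slice_dom U z ->
  d_u alpha z - d_v beta z = 0 /\ d_v alpha z + d_u beta z = 0.

(** The factor [v^-1] is moved from the unit [w / v] onto [beta], so that the left factor [w] is
    affine along every line. *)
Lemma slice_reE q : U q -> qvec q != 0 ->
  let v := qabs (qvec q) in
  f q = alpha (qre q, v) + qvec q * (v^-1 *: beta (qre q, v)).
Proof.
move=> Uq q0 v; rewrite [in LHS](qpolar q0).
rewrite (fE (slice_dom_qvec symU Uq q0) (imunits_qvec q0)).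
by rewrite -scalerAl -scalerAr.
Qed.

Lemma is_derive_u (a : R * R -> quat R) (u v : R) : derivable a (u, v) (1, 0) ->
  is_derive (0 : R) 1 (fun t => a (t + u, v)) (d_u a (u, v)).
Proof.
move=> /is_derive_along_line.
have -> // : (fun t : R => a (t *: (1, 0) + (u, v))) = fun t => a (t + u, v).
apply/funext => t; transitivity (a (t * 1 + u, t * 0 + v)) => //.
by rewrite mulr1 mulr0 add0r.
Qed.

(** Based at [v] rather than at 0, so that it composes with the moving norm [r] in the chain
    rule. *)
Lemma is_derive_v (a : R * R -> quat R) (u v : R) : derivable a (u, v) (0, 1) ->
  is_derive v 1 (fun s => a (u, s)) (d_v a (u, v)).
Proof.
move=> d; apply: is_derive_line.
have -> : (fun t : R => a (u, t *: 1 + v)) =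
    fun t => a (t *: (0, 1) + (u, v)); last exact: is_derive_along_line.
apply/funext => t; transitivity (a (t * 0 + u, t * 1 + v)) => //.
by rewrite mulr0 add0r.
Qed.

Lemma slice_derive0 q : U q -> qvec q != 0 ->
  let z := (qre q, qabs (qvec q)) in
  is_derive q (qe R 0) f
    (d_u alpha z + qvec q * (z.2^-1 *: d_u beta z)).
Proof.
move=> Uq q0 z; have zU : slice_dom U z by exact: slice_dom_qvec.
apply: is_derive_line.
have vecE t : qvec (t *: qe R 0 + q) = qvec q.
  by apply: quatP; rewrite /qvec /qre !qcoordE/=; ring.
have reE t : qre (t *: qe R 0 + q) = t + qre q.
  by rewrite /qre !qcoordE/= mulr1.
apply: (@near_eq_is_derive _ _ _ (fun t => alpha (t + z.1, z.2) +
    qvec q * (z.2^-1 *: beta (t + z.1, z.2)))).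
  near=> t; rewrite slice_reE ?vecE//; last by near: t; exact: near_line.
  by rewrite reE.
have da := is_derive_u (alphaP zU).1.
have db := is_derive_u (betaP zU).1.
have dc := is_deriveMq (is_derive_cst (qvec q) (0 : R) 1)
  (is_deriveZq (is_derive_cst z.2^-1 (0 : R) 1) db).
apply: is_derive_eq.
by rewrite mul0r scale0r !add0r.
Unshelve. all: by end_near. Qed.

(** The terms with factor [qcoord q i] come from the change of [v], the last one from the change of
    the vector part in the direction [e_i]. *)
Lemma slice_derive_vec q (i : 'I_4) : i != 0 -> U q -> qvec q != 0 ->
  let z := (qre q, qabs (qvec q)) in
  is_derive q (qe R i) f
    (qcoord q i *: (z.2^-1 *: (d_v alpha z +
        qvec q * (- z.2^-2 *: beta z + z.2^-1 *: d_v beta z))) +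
     z.2^-1 *: (qe R i * beta z)).
Proof.
move=> i0 Uq q0 z; have zU : slice_dom U z by exact: slice_dom_qvec.
apply: is_derive_line.
pose r t := qabs (qvec (t *: qe R i + q)).
have r0 : r 0 = z.2 by rewrite /r scale0r add0r.
have z0 : z.2 != 0 by rewrite qabs_eq0.
have dr : is_derive (0 : R) 1 r (qcoord q i / z.2) := is_derive_qabs_line i0 q0.
have dw := is_derive_affine (qvec q) (qe R i).
apply: (@near_eq_is_derive _ _ _ (fun t => alpha (z.1, r t) +
    (t *: qe R i + qvec q) * ((r t)^-1 *: beta (z.1, r t)))).
  near=> t; rewrite slice_reE ?qvec_line ?qre_line//.
  - by rewrite /r qvec_line.
  - by near: t; exact: near_line.
  (* The line stays off the real axis for small [t], because [r] is continuous at 0 and [r 0] is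
     nonzero. *)
  - rewrite -qvec_line// -qabs_eq0; near: t.
    have /differentiable_continuous : differentiable r 0.
      by apply/derivable1_diffP; case: dr.
    by move/cvgr_neq0; apply; rewrite r0.
have da : is_derive (r 0) 1 (fun s => alpha (z.1, s)) (d_v alpha z).
  by rewrite r0; exact: is_derive_v (alphaP zU).2.
have db : is_derive (r 0) 1 (fun s => beta (z.1, s)) (d_v beta z).
  by rewrite r0; exact: is_derive_v (betaP zU).2.
have di : is_derive (r 0) 1 (fun s : R => s^-1) (- z.2^-2).
  rewrite r0; have := @is_deriveV _ id _ _ _ z0
    (is_derive_id (z.2 : R^o) (1 : R^o)).
  by rewrite [_ *: _]mulr1.
have dg := is_derive_comp_real (is_deriveZq di db) dr.
have da' := is_derive_comp_real da dr.
have dp := is_deriveMq dw dg.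
apply: is_derive_eq.
rewrite /= scale0r add0r r0 -!scalerAr scalerA scalerDr -addrA; congr (_ + _).
by rewrite addrC.
Unshelve. all: by end_near. Qed.

Lemma cauchy_fueter_nonreal q : U q -> qvec q != 0 ->
  let v := qabs (qvec q) in
  cauchy_fueter f q = - ((2 / v) *: beta (qre q, v)).
Proof.
move=> Uq q0 v; pose z := (qre q, v).
have zU : slice_dom U z by exact: slice_dom_qvec.
have v0 : v != 0 by rewrite qabs_eq0.
have [_ D0] := slice_derive0 Uq q0.
have DV i (i0 : i != 0) :=
  @derive_val _ _ _ _ _ _ _ (slice_derive_vec i0 Uq q0).
have duA : d_u alpha z = d_v beta z by apply/eqP; rewrite -subr_eq0 (CR zU).1.
have duB : d_u beta z = - d_v alpha z.
  by apply/eqP; rewrite -addr_eq0 addrC (CR zU).2.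
rewrite /cauchy_fueter big_ord4 D0 !DV// -/v -/z /= duA duB.
set A := d_v alpha z; set B := beta z; set B' := d_v beta z.
set C := - v ^- 2 *: B + _; set X := v^-1 *: (A + _).
(* The sum splits into three groups: [e_0] gives [B' - w A / v], the change of [v] gives
   [w (A + w C) / v], and the change of [w] gives [- 3 B / v]. *)
rewrite qe0 mul1r !(mulrDr (qe R _)) addrD3 sum_qe_vec.
rewrite -![qe R _ * (v^-1 *: _)]scalerAr -!scalerDr sum_qe_qe.
rewrite /X -!scalerAr mulrDr mulrA qvec_sqr -/v mulNr -scalerAl mul1r mulrN.
(* Since [w^2 = - v^2], the second group is [w A / v + B / v - B']. The product [w A] cancels as a
   whole and can be generalized. *)
rewrite /C; move: (qvec q * A) => Z.
by apply: quatP; rewrite !qcoordE; field.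
Qed.

(** * Derivatives at real points *)

Lemma near_slice_dom_v (u : R) : U u%:A ->
  \forall t \near (0 : R), slice_dom U (u, t).
Proof.
move=> Uu; have := near_line (qe R 1) openU Uu; apply: filterS => t Ut.
(* Any imaginary unit would serve in place of [e_1]; [t] may have either sign. *)
by apply: (slice_dom_sphere symU (@imunits_qe R 1 isT)); rewrite addrC.
Qed.

Lemma near_slice_dom_u (u : R) : U u%:A ->
  \forall t \near (0 : R), slice_dom U (t + u, 0).
Proof.
move=> Uu; have := near_line 1 openU Uu; apply: filterS => t Ut.
apply: (slice_dom_sphere symU (@imunits_qe R 1 isT)).
by rewrite scale0r addr0 scalerDl.
Qed.

Lemma slice_dom_real (u : R) : U u%:A -> slice_dom U (u, 0).
Proof. by move=> Uu; exact: nbhs_singleton (near_slice_dom_v Uu). Qed.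

Lemma slice_beta0 (u : R) : slice_dom U (u, 0) -> beta (u, 0) = 0.
Proof.
move=> /parity[_]; rewrite oppr0 => /eqP; rewrite -addr_eq0 -mulr2n.
by rewrite -scaler_nat scaler_eq0 pnatr_eq0 => /eqP.
Qed.

(** Differentiating [alpha (u, t) = alpha (u, - t)], valid for [t] near 0, shows that the derivative
    equals its own opposite. *)
Lemma slice_d_v_alpha0 (u : R) : U u%:A -> d_v alpha (u, 0) = 0.
Proof.
move=> Uu; have zU := slice_dom_real Uu.
have da := is_derive_v (alphaP zU).2.
have dN : is_derive (0 : R) 1 (fun t : R => - t) (-1).
  by apply: is_derive_eq.
have da' : is_derive (0 : R) 1 (fun t => alpha (u, t)) (-1 *: d_v alpha (u, 0)).
  apply: (@near_eq_is_derive _ _ _ ((fun s => alpha (u, s)) \o (fun t => - t))).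
    have := near_slice_dom_v Uu; apply: filterS => t tU /=.
    by rewrite -(parity tU).1.
  by apply: is_derive_comp_real dN; rewrite oppr0.
have : d_v alpha (u, 0) = -1 *: d_v alpha (u, 0).
  by rewrite -[LHS](@derive_val _ _ _ _ _ _ _ da)
    (@derive_val _ _ _ _ _ _ _ da').
move/eqP; rewrite scaleN1r -addr_eq0 -mulr2n.
by rewrite -scaler_nat scaler_eq0 pnatr_eq0 => /eqP.
Qed.

(** On the real axis [beta] vanishes, so [f] is [alpha (., 0)] there. This yields both the partial
    derivative along [e_0] and the derivative in [u] of the final formula. *)
Lemma slice_derive_real (u : R) : U u%:A ->
  is_derive (0 : R) 1 (fun t : R => f (t + u)%:A) (d_u alpha (u, 0)).
Proof.
move=> Uu; have zU := slice_dom_real Uu.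
apply: near_eq_is_derive (is_derive_u (alphaP zU).1).
have := near_slice_dom_u Uu; apply: filterS => t tU.
have := fE tU (@imunits_qe R 1 isT).
by rewrite slice_beta0// mulr0 addr0 scale0r addr0.
Qed.

Lemma slice_derive_real0 (u : R) : U u%:A ->
  is_derive (u%:A : quat R) (qe R 0) f (d_u alpha (u, 0)).
Proof.
move=> Uu; apply: is_derive_line.
apply: near_eq_is_derive (slice_derive_real Uu).
near=> t; congr f; apply: quatP; rewrite !qcoordE/=; ring.
Unshelve. all: by end_near. Qed.

Lemma slice_derive_real_vec (u : R) (i : 'I_4) : i != 0 -> U u%:A ->
  is_derive (u%:A : quat R) (qe R i) f (qe R i * d_v beta (u, 0)).
Proof.
move=> i0 Uu; have zU := slice_dom_real Uu.
apply: is_derive_line.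
apply: (@near_eq_is_derive _ _ _
  (fun t => alpha (u, t) + qe R i * beta (u, t))).
  have := near_slice_dom_v Uu; apply: filterS => t tU.
  by rewrite [t *: _ + _]addrC (fE tU (imunits_qe i0)).
have da := is_derive_v (alphaP zU).2.
have db := is_deriveMq (is_derive_cst (qe R i) (0 : R) 1)
  (is_derive_v (betaP zU).2).
apply: is_derive_eq.
by rewrite slice_d_v_alpha0// mul0r !add0r.
Qed.

Lemma cauchy_fueter_real (u : R) : U u%:A ->
  cauchy_fueter f u%:A = - (2 *: d_u alpha (u, 0)).
Proof.
move=> Uu; have zU := slice_dom_real Uu.
have [_ D0] := slice_derive_real0 Uu.
have DV i (i0 : i != 0) :=
  @derive_val _ _ _ _ _ _ _ (slice_derive_real_vec i0 Uu).
rewrite /cauchy_fueter big_ord4 D0 !DV//.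
have [/eqP + _] := CR zU; rewrite subr_eq0 => /eqP ->.
by apply: quatP; rewrite !qcoordE/=; ring.
Qed.

Lemma derive1_slice_real (u : R) : U u%:A ->
  derive1 (fun t : R => f t%:A) u = d_u alpha (u, 0).
Proof.
move=> Uu; rewrite derive1E; apply: derive_val; apply: is_derive_line.
by under eq_fun do rewrite [_ *: (1 : R)]mulr1; exact: slice_derive_real.
Qed.

(** ['D_v f] is a total expression; this existence result makes the values in [cauchy_fueter]
    genuine partial derivatives. *)
Lemma slice_partials q : U q -> partials_exist f q.
Proof.
move=> Uq i; have [q0|q0] := eqVneq (qvec q) 0.
  have [u _ uq] := (qvec_eq0 q).1 q0; rewrite -uq in Uq *.
  have [->|i0] := eqVneq i 0; first by case: (slice_derive_real0 Uq).
  by case: (slice_derive_real_vec i0 Uq).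
have [->|i0] := eqVneq i 0; first by case: (slice_derive0 Uq q0).
by case: (slice_derive_vec i0 Uq q0).
Qed.

End SliceFunctions.

(** * The Cauchy-Fueter image of a slice hyperholomorphic function *)

Theorem theorem4p2 (R : realType) (U : set (quat R)) (f : quat R -> quat R)
    (openU : open U) (connU : connected U) (symU : axially_symmetric U)
    (slicef : slice_hyperholomorphic U f) :
  let g := cauchy_fueter f in
  [/\ forall q, U q -> partials_exist f q,
      forall q, U q -> ~ qreals q ->
        let u := qre q in
        let v := qabs (qvec q) in
        let Iq := v^-1 *: qvec q in
        forall I, imunits I ->
          g q = - (qvec q)^-1 * Iq * I *
                (f (u%:A - v *: I) - f (u%:A + v *: I)),
      forall q, U q -> ~ qreals q -> forall p, qsphere q p -> g p = g q &
      forall u : R, U u%:A ->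
        g u%:A = - (2 *: derive1 (fun t : R => f t%:A) u)].
Proof.
case: slicef => alpha [beta [[alphaP _ _] [betaP _ _] fE parity CR]] g.
have nonreal q : ~ qreals q -> qvec q != 0.
  by move=> q0; apply/eqP => /qvec_eq0.
have gE q (Uq : U q) (q0 : qvec q != 0) :=
  cauchy_fueter_nonreal openU symU alphaP betaP fE CR Uq q0.
split=> [q Uq|q Uq /nonreal q0 u v Iq I I1|q Uq /nonreal q0 p qp|u Uu].
- exact: (slice_partials openU symU alphaP betaP fE parity Uq).
- have v0 : v != 0 by rewrite qabs_eq0.
  have zU : slice_dom U (u, v) by exact: slice_dom_qvec.
  (* As [u - v I = u + v (- I)] and [- I] is again an imaginary unit, the slice formula applies to
     both values of [f], and [alpha] drops out of the difference. *)
  rewrite -[- (v *: I)]scalerN (fE _ _ zU _ (imunitsN I1)) (fE _ _ zU _ I1).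
  rewrite /g gE// -/u -/v.
  have -> : alpha (u, v) + - I * beta (u, v) -
      (alpha (u, v) + I * beta (u, v)) =
      - (2 *: (I * beta (u, v))).
    by rewrite opprD addrACA subrr add0r mulNr -opprD scaler_nat mulr2n.
  (* The prefactor is the real number [- 1 / v], so the two factors [I] meet and give -1. *)
  have -> : - (qvec q)^-1 * Iq = - (v^-1)%:A.
    by rewrite /Iq mulNr -scalerAr mulVr.
  rewrite mulNr mulrN mulNr opprK -!scalerAl mul1r -scalerAr mulrA.
  by rewrite imunits_mulK// mulN1r !scalerN scalerA [v^-1 * _]mulrC.
- have [pu pv] := qsphere_qabs qp.
  have Up : U p by exact: symU qp.
  have p0 : qvec p != 0 by rewrite -qabs_eq0 pv qabs_eq0.
  by rewrite /g !gE// pu pv.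
- rewrite (derive1_slice_real openU symU alphaP fE parity Uu).
  exact: (cauchy_fueter_real openU symU alphaP betaP fE parity CR Uu).
Qed.
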